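(* Let $A\in\mathbb{R}^{n\times n}$. Assume that every value in $\Pi(A)$ is produced by exactly one support and that this production is regular. Then $|\Pi(A)|\equiv 1\pmod 2$.
   Context: For $A\in\mathbb{R}^{n\times n}$ ($n\ge1$), a real number $\lambda$ is a Pareto eigenvalue of $A$ if there exists $x\in\mathbb{R}^n\setminus\{0\}$ with $x\ge 0$, $Ax-\lambda x\ge 0$ (componentwise) and $\langle x,Ax-\lambda x\rangle=0$; $\Pi(A)$ is the set of Pareto eigenvalues of $A$. A support is a nonempty subset $J\subseteq\{1,\dots,n\}$; $A_J$ is the principal submatrix indexed by $J$, $J^{\mathrm c}$ is the complement of $J$, and $A_{J^{\mathrm c},J}$ is the block with rows in $J^{\mathrm c}$ and columns in $J$. The support $J$ produces $\lambda\in\mathbb{R}$ if there is $u\in\mathbb{R}^J$ with $A_Ju=\lambda u$, $u>0$ (all entries positive) and $A_{J^{\mathrm c},J}u\ge 0$. The production is regular if $\lambda$ is an algebraically simple eigenvalue of $A_J$ and $A_{J^{\mathrm c},J}u>0$ componentwise for a positive eigenvector $u$ (empty condition if $J=\{1,\dots,n\}$). *)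

(* Defs.v *)
From HB Require Import structures.
From mathcomp Require Import all_boot all_order all_algebra.
From mathcomp Require Import finmap.
From mathcomp Require Import boolp classical_sets functions cardinality reals.

Set Implicit Arguments.
Unset Strict Implicit.
Unset Printing Implicit Defensive.

Import Order.TTheory GRing.Theory Num.Theory.

Local Open Scope classical_set_scope.
Local Open Scope ring_scope.

Definition cvec_ge0 (R : realType) (m : nat) (v : 'cV[R]_m) : Prop :=
  forall i, 0 <= v i 0.

Definition cvec_gt0 (R : realType) (m : nat) (v : 'cV[R]_m) : Prop :=
  forall i, 0 < v i 0.

Definition dotcv (R : realType) (m : nat) (x y : 'cV[R]_m) : R :=
  \sum_i x i 0 * y i 0.

Definition pareto_eigenvalue (R : realType) (n : nat) (A : 'M[R]_n)
    (lambda : R) : Prop :=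
  exists x : 'cV[R]_n,
    [/\ x != 0, cvec_ge0 x, cvec_ge0 (A *m x - lambda *: x)
      & dotcv x (A *m x - lambda *: x) = 0].

Definition pareto_spectrum (R : realType) (n : nat) (A : 'M[R]_n) : set R :=
  [set lambda | pareto_eigenvalue A lambda].

(* Rows and columns are listed in the increasing order of [enum]. *)
Definition setmx (R : realType) (n : nat) (A : 'M[R]_n) (I J : {set 'I_n}) :
    'M[R]_(#|I|, #|J|) :=
  mxsub (fun i : 'I_#|I| => enum_val i) (fun j : 'I_#|J| => enum_val j) A.

Definition principal_submx (R : realType) (n : nat) (A : 'M[R]_n)
    (J : {set 'I_n}) : 'M[R]_#|J| :=
  setmx A J J.

Definition is_support (n : nat) (J : {set 'I_n}) : Prop := J != finset.set0.

Definition positive_eigenvector (R : realType) (n : nat) (A : 'M[R]_n)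
    (J : {set 'I_n}) (lambda : R) (u : 'cV[R]_#|J|) : Prop :=
  principal_submx A J *m u = lambda *: u /\ cvec_gt0 u.

Definition produces (R : realType) (n : nat) (A : 'M[R]_n) (J : {set 'I_n})
    (lambda : R) : Prop :=
  is_support J /\
  exists u : 'cV[R]_#|J|,
    positive_eigenvector A lambda u /\ cvec_ge0 (setmx A (~: J) J *m u).

Definition alg_simple_eigenvalue (R : realType) (m : nat) (B : 'M[R]_m)
    (lambda : R) : Prop :=
  mup lambda (char_poly B) = 1%N.

Definition regular_production (R : realType) (n : nat) (A : 'M[R]_n)
    (J : {set 'I_n}) (lambda : R) : Prop :=
  alg_simple_eigenvalue (principal_submx A J) lambda /\
  exists u : 'cV[R]_#|J|,
    positive_eigenvector A lambda u /\ cvec_gt0 (setmx A (~: J) J *m u).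

(* Main.v *)
Require Import Defs.
From HB Require Import structures.
From mathcomp Require Import all_boot all_order all_algebra.
From mathcomp Require Import finmap.
From mathcomp Require Import boolp classical_sets functions cardinality reals.
From mathcomp Require Import ring lra.
From mathcomp Require polyrcf.

(* Fix q with negative entries and, for a support J, let B_J(t) be the matrix
   whose j-th column is that of t I - A if j is in J and e_j otherwise.  Its
   determinant is the characteristic polynomial of A_J.  Say that J solves t if
   the solution z of B_J(t) z = q is positive: then x = z_J and w = z_{J^c},
   extended by 0, solve the linear complementarity problem w = (A - t I) x + q.
   For t near -oo only the full support solves t, and for t near +oo no support
   does, so the parity of the number of solving supports changes an odd number
   of times along the real line.

   For q generic, (1) q is never in the image of a singular B_J(t), and (2) a
   solution z never has two zero entries.  If one entry i of z vanishes at t = c,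
   then z also solves the system of the support J' obtained by toggling i, and J
   and J' contribute equally to the change of parity at c.  If B_J(c) is singular
   and J solves t on one side of c, the direction in which z blows up is a
   nonnegative kernel vector of B_J(c), that is, a Pareto eigenvector; regularity
   and uniqueness then make J the support producing c, and the simple pole makes
   z positive on exactly one side of c.  So the parity changes exactly at the
   Pareto eigenvalues. *)

Set Implicit Arguments.
Unset Strict Implicit.
Unset Printing Implicit Defensive.

Import Order.TTheory GRing.Theory Num.Theory.

(** * The matrices [B_J(t)], their determinants and adjugates *)

Section ShiftMatrix.
Local Open Scope ring_scope.
Variables (T : comNzRingType) (n : nat).
Implicit Types (A : 'M[T]_n) (J K : {set 'I_n}) (t : T).

(** The ring is left general so that [t] may be a real number or the indeterminate ['X]. *)
Definition shift_mx A J t : 'M[T]_n :=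
  \matrix_(i, j) if j \in J then t *+ (i == j) - A i j else (i == j)%:R.

Lemma shift_mulE A J t (z : 'cV_n) i :
  (shift_mx A J t *m z) i 0 =
  (if i \in J then t else 1) * z i 0 - \sum_(j in J) A i j * z j 0.
Proof.
rewrite mxE [X in _ - X]big_mkcond /= (bigD1 i) //= [X in _ - X](bigD1 i) //=.
rewrite mxE eqxx opprD addrA -sumrN; congr (_ + _).
  by case: ifP => _; [rewrite mulrBl | rewrite subr0].
apply: eq_bigr => j /negPf ji; rewrite mxE eq_sym ji mulr0n.
by case: ifP => _; rewrite ?sub0r ?mulNr ?mul0r ?oppr0.
Qed.

(** Sylvester's identity: the block matrix with rows [1, -E] and [G, 1] factors into block
    triangular matrices in two ways. *)
Lemma det_one_plus_mulC m (E : 'M[T]_(m, n)) (G : 'M[T]_(n, m)) :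
  \det (1%:M + G *m E) = \det (1%:M + E *m G).
Proof.
have e1 : block_mx 1%:M (- E) G 1%:M =
    block_mx 1%:M 0 G 1%:M *m block_mx 1%:M (- E) 0 (1%:M + G *m E).
  rewrite mulmx_block !mul1mx !mulmx1 !mul0mx !addr0 mulmxN addrCA addNr.
  by rewrite addr0.
have e2 : block_mx 1%:M (- E) G 1%:M =
    block_mx (1%:M + E *m G) (- E) 0 1%:M *m block_mx 1%:M 0 G 1%:M.
  by rewrite mulmx_block !mul1mx !mulmx1 !mulmx0 !mulNmx addrK !add0r.
have := congr1 determinant e1; rewrite e2 !det_mulmx !det_ublock !det_lblock.
by rewrite !det1 !mul1r !mulr1 => ->.
Qed.

(* [shift_mx A J t] differs from the identity only in the columns of [J], so it is
   [1 + G E] with [E] selecting [J]. *)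
Lemma det_shift A J t :
  \det (shift_mx A J t) =
  \det (t%:M - mxsub (fun i : 'I_#|J| => enum_val i) (fun j => enum_val j) A).
Proof.
pose E : 'M[T]_(#|J|, n) := \matrix_(i, j) (enum_val i == j)%:R.
pose G : 'M[T]_(n, #|J|) :=
  \matrix_(i, j) (shift_mx A J t - 1%:M) i (enum_val j).
have -> : shift_mx A J t = 1%:M + G *m E.
  apply/matrixP => i j; rewrite !mxE; case: ifPn => jJ.
    rewrite (bigD1 (enum_rank_in jJ j)) //= !mxE enum_rankK_in // jJ eqxx mulr1.
    rewrite big1 ?addr0; last first.
      move=> k /negPf kj; rewrite !mxE.
      by rewrite -(inj_eq enum_val_inj) enum_rankK_in // in kj; rewrite kj mulr0.
    by rewrite addrC subrK.
  rewrite big1 ?addr0 // => k _; rewrite !mxE.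
  by case: (enum_val k =P j) => [kj|]; [rewrite -kj enum_valP in jJ | rewrite mulr0].
rewrite det_one_plus_mulC; congr determinant; apply/matrixP => i j.
rewrite !mxE (bigD1 (enum_val i)) //= !mxE eqxx enum_valP.
rewrite big1 ?addr0; last first.
  by move=> k /negPf ki; rewrite !mxE eq_sym ki mul0r.
by rewrite (inj_eq enum_val_inj) mul1r addrC subrK.
Qed.

(** Row [i] of an adjugate consists of cofactors that omit column [i], the only column in which the
    two matrices can differ. *)
Lemma adj_shift_row A J K t i (q : 'cV_n) :
  (forall j, j != i -> (j \in J) = (j \in K)) ->
  (\adj (shift_mx A J t) *m q) i 0 = (\adj (shift_mx A K t) *m q) i 0.
Proof.
move=> JK; rewrite !mxE; apply: eq_bigr => k _; congr (_ * _).
rewrite !mxE /cofactor; congr (_ * _); congr determinant.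
by apply/matrixP => a b; rewrite !mxE JK // eq_sym neq_lift.
Qed.

Lemma shift_mul_agree A J K t i (z : 'cV_n) :
  (forall j, j != i -> (j \in J) = (j \in K)) -> z i 0 = 0 ->
  shift_mx A J t *m z = shift_mx A K t *m z.
Proof.
move=> JK zi; apply/colP => k; rewrite !mxE; apply: eq_bigr => j _.
have [->|ji] := eqVneq j i; first by rewrite zi !mulr0.
by rewrite !mxE JK.
Qed.

End ShiftMatrix.

Section MapShift.
Local Open Scope ring_scope.

Lemma map_shift_mx (T T' : comNzRingType) (f : {rmorphism T -> T'}) n
    (A : 'M[T]_n) (J : {set 'I_n}) t :
  map_mx f (shift_mx A J t) = shift_mx (map_mx f A) J (f t).
Proof.
apply/matrixP => i j; rewrite !mxE; case: ifP => _; last by rewrite rmorph_nat.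
by rewrite rmorphB rmorphMn.
Qed.

End MapShift.

(** * Signs of real polynomials and changes of parity along the line *)

Section PolySign.
Local Open Scope ring_scope.
Variable R : rcfType.
Implicit Types (p : {poly R}) (a b c s : R).

Lemma poly_sign_itv p a b :
  a <= b -> (forall t, a <= t <= b -> p.[t] != 0) -> (0 < p.[a]) = (0 < p.[b]).
Proof.
move=> ab nz; apply/eqP/negPn/negP => ne.
have [|x] := polyrcf.poly_ivtoo (p := p) ab.
  have := nz a; have := nz b; rewrite !lexx !ab => /(_ isT) nb /(_ isT) na.
  move: na nb ne.
  case: (ltrgt0P p.[a]) => pa; case: (ltrgt0P p.[b]) => pb //= _ _ _.
    by rewrite pmulr_rlt0.
  by rewrite nmulr_rlt0.
rewrite in_itv /= => /andP[ax xb]; rewrite /root => /eqP px.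
by have := nz x; rewrite px eqxx !ltW // => /(_ isT).
Qed.

Lemma poly_sign_ray p c s a b :
  a <= b -> (forall t, a <= t <= b -> p.[c + s * t] != 0) ->
  (0 < p.[c + s * a]) = (0 < p.[c + s * b]).
Proof.
move=> ab nz; have E t : (p \Po (s *: 'X + c%:P)).[t] = p.[c + s * t].
  by rewrite horner_comp !(hornerD, hornerZ, hornerX, hornerC) addrC.
by rewrite -!E; apply: poly_sign_itv => // t; rewrite E; apply: nz.
Qed.

Lemma poly_side_ge0 p c s e :
  0 < e -> (forall t, 0 < t <= e -> 0 < p.[c + s * t]) -> 0 <= p.[c].
Proof.
move=> e0 pos; have [//|neg] := leP.
suff : (0 < p.[c + s * 0]) = (0 < p.[c + s * e]).
  by rewrite mulr0 addr0 (pos e) ?e0 ?lexx // lt_gtF.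
apply: poly_sign_ray; first exact: ltW.
move=> t; rewrite le_eqVlt => /andP[/predU1P[<-|t0] te].
  by rewrite mulr0 addr0 lt_eqF.
by rewrite gt_eqF // pos // t0.
Qed.

Lemma simple_root_factor p c : p != 0 -> mup c p = 1%N ->
  exists2 r, p = ('X - c%:P) * r & r.[c] != 0.
Proof.
move=> p0 m1; have : root p c by rewrite -dvdp_XsubCl XsubC_dvd // m1.
case/factor_theorem => r pE; exists r; first by rewrite mulrC.
apply/negP => /factor_theorem[r' rE].
have : (1 < mup c p)%N by rewrite mup_geq // pE rE -mulrA -expr2 dvdp_mull.
by rewrite m1.
Qed.

Lemma seq_isolate (S : seq R) c :
  exists2 e, 0 < e & forall x, x \in S -> x != c -> e < `|x - c|.
Proof.
elim: S => [|y S [e e0 he]]; first by exists 1.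
have [->|yc] := eqVneq y c.
  by exists e => // x; rewrite inE => /predU1P[->|/he//]; rewrite eqxx.
have d0 : 0 < `|y - c| by rewrite normr_gt0 subr_eq0.
exists (Num.min e (`|y - c| / 2)); first by rewrite lt_min e0 divr_gt0.
move=> x; rewrite inE gt_min => /predU1P[-> _|xS xc]; last by rewrite he.
by apply/orP; right; lra.
Qed.

(** Induction along the sorted list [S]: [N] is constant between consecutive points, so the xor of
    its end values telescopes into the jumps at the points of [S]. *)
Lemma parity_sweep (N P : R -> bool) (S : seq R) a b :
  path <%R a (rcons S b) ->
  (forall x y, a <= x -> x < y -> y <= b ->
     (forall t, x <= t <= y -> t \notin S) -> N x = N y) ->
  (forall c, c \in S -> exists2 e0, 0 < e0 &
     forall e, 0 < e <= e0 -> N (c - e) (+) N (c + e) = P c) ->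
  N a (+) N b = odd (count P S).
Proof.
elim: S a => [|c S IH] a /=.
  by rewrite andbT => ab /(_ a b (lexx a) ab (lexx b))-> //; rewrite addbb.
move=> /andP[ac pS] const cross.
have [e1 e1_gt0 iso] := seq_isolate (a :: b :: S) c.
have [|e2 e2_gt0 cr] := cross c; first by rewrite mem_head.
pose e := Num.min e1 e2.
have e0 : 0 < e by rewrite lt_min e1_gt0.
have ee1 : e <= e1 by rewrite ge_min lexx.
have ltS x : x \in rcons S b -> c + e < x.
  move=> xS; have cx : c < x by apply: (allP (order_path_min lt_trans pS)).
  have := iso x; rewrite inE -mem_rcons xS orbT gt_eqF // gtr0_norm ?subr_gt0 //.
  by move=> /(_ isT isT) h; lra.
have ace : a < c - e.
  have := iso a; rewrite mem_head lt_eqF // ltr0_norm ?subr_lt0 //.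
  by move=> /(_ isT isT) h; lra.
have ceb : c + e < b by rewrite ltS // mem_rcons mem_head.
have -> : N a = N (c - e).
  apply: const => //; first by lra.
  move=> t /andP[_ tc]; rewrite inE negb_or lt_eqF /=; last by lra.
  apply/negP => tS; have := ltS t; rewrite mem_rcons inE tS orbT => /(_ isT); lra.
have IHc : N (c + e) (+) N b = odd (count P S).
  apply: IH => [|x y ax xy yb noS|d dS]; last by apply: cross; rewrite inE dS orbT.
    case: S pS ltS {cross const iso} => [|d S] /= pS ltS; first by rewrite andbT.
    by case/andP: pS => _ ->; rewrite andbT ltS // mem_head.
  apply: const => // [|t txy]; first by lra.
  rewrite inE negb_or noS // andbT gt_eqF //; case/andP: txy => xt _; lra.
rewrite oddD -IHc -(cr e) ?e0 ?ge_min ?lexx ?orbT // oddb.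
by rewrite addbA -[in RHS](addbA (N (c - e))) addbb addbF.
Qed.

End PolySign.

(** * Two finite counts: fixed-point-free involutions and avoidance on a grid *)

Lemma odd_card_involution (T : finType) (f : T -> T) (A : {set T}) :
  {in A, forall x, [/\ f x \in A, f x != x & f (f x) = x]} -> odd #|A| = false.
Proof.
have [m] := ubnP #|A|; elim: m A => // m IH A Am fA.
have [->|[x xA]] := set_0Vmem A; first by rewrite cards0.
have [fxA fxx ffx] := fA x xA.
have xA' : x \in A :\ f x by rewrite !inE eq_sym fxx.
have c : #|A| = #|(A :\ f x) :\ x|.+2.
  by rewrite (cardsD1 (f x)) fxA (cardsD1 x) xA'.
rewrite c /= negbK; apply: IH; first by rewrite c !ltnS in Am; apply: leq_trans Am.
move=> y; rewrite !inE => /and3P[yx yfx yA]; have [fyA fyy ffy] := fA y yA.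
split=> //; rewrite fyA andbT; apply/andP; split.
  by apply: contra yfx => /eqP <-; rewrite ffy.
by apply: contra yx => /eqP e; rewrite -ffy e ffx.
Qed.

Section GridAvoidance.
Local Open Scope ring_scope.

Definition set_coord (R : pzRingType) n (q : 'cV[R]_n) (i : 'I_n) (x : R) :
    'cV[R]_n :=
  \col_j if j == i then x else q j 0.

(* A bad set meeting every line parallel to a fixed axis in at most [c] points
   fills a fraction at most [c / m] of the grid [{-1, ..., -m}^n]. *)
Lemma grid_avoid (R : realDomainType) n (T : finType) (dir : T -> 'I_n)
    (bad : T -> 'cV[R]_n -> Prop) (c : nat) :
  (forall t q s, uniq s ->
     (forall x, x \in s -> bad t (set_coord q (dir t) x)) -> (size s <= c)%N) ->
  exists q : 'cV[R]_n, (forall i, q i 0 < 0) /\ forall t, ~ bad t q.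
Proof.
(* With [m.+1] values per axis, each [t] spoils at most a fraction [c / m.+1] of the grid, and these
   fractions sum to less than 1. *)
move=> small; pose m := (#|T| * c)%N.
pose pt (f : {ffun 'I_n -> 'I_m.+1}) : 'cV[R]_n := \col_i - (f i).+1%:R.
pose B t := [set f | `[< bad t (pt f) >]].
pose sh i (a : 'I_m.+1) (f : {ffun 'I_n -> 'I_m.+1}) : {ffun 'I_n -> 'I_m.+1} :=
  [ffun j => if j == i then f j + a else f j].
have shK i a : cancel (sh i a) (sh i (- a)).
  by move=> f; apply/ffunP => j; rewrite !ffunE; case: eqP => // _; rewrite addrK.
have shK' i a : cancel (sh i (- a)) (sh i a).
  by move=> f; apply/ffunP => j; rewrite !ffunE; case: eqP => // _; rewrite subrK.
have leB t : (m.+1 * #|B t| <= c * #|{ffun 'I_n -> 'I_m.+1}|)%N.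
  (* Double counting: [sh] adds [a] cyclically along the axis [dir t], so it permutes the grid; for
     a fixed [f] the shifts run through one line. *)
  have -> : (m.+1 * #|B t| = \sum_(a : 'I_m.+1) \sum_f (sh (dir t) a f \in B t))%N.
    transitivity (\sum_(a : 'I_m.+1) #|B t|)%N; first by rewrite sum_nat_const card_ord.
    apply: eq_bigr => a _.
    rewrite -sum1_card (reindex (sh (dir t) a)) /=; last first.
      by exists (sh (dir t) (- a)) => f _; rewrite ?shK ?shK'.
    by rewrite big_mkcond /=; apply: eq_bigr => f _; case: (_ \in _).
  rewrite exchange_big /= mulnC -sum_nat_const; apply: leq_sum => f _.
  pose D := [set a | sh (dir t) a f \in B t].
  have -> : (\sum_a (sh (dir t) a f \in B t) = #|D|)%N.
    rewrite -sum1_card [RHS]big_mkcond; apply: eq_bigr => a _.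
    by rewrite [in RHS]inE; case: (_ \in _).
  pose s : seq R := [seq - (nat_of_ord (f (dir t) + a)).+1%:R | a : 'I_m.+1 <- enum D].
  have -> : #|D| = size s by rewrite size_map cardE.
  apply: (small t (pt f)).
    rewrite map_inj_uniq ?enum_uniq // => a b /eqP.
    by rewrite eqr_opp eqr_nat eqSS => /eqP/val_inj/addrI.
  move=> _ /mapP[a aD ->]; move: aD; rewrite mem_enum !inE.
  rewrite (_ : pt _ = set_coord (pt f) (dir t) (- (nat_of_ord (f (dir t) + a)).+1%:R)) //.

  by apply/colP => j; rewrite !mxE ffunE; case: eqP => [->|].
have [/existsP[f /forallP fB]|] :=
    boolP [exists f : {ffun 'I_n -> 'I_m.+1}, forall t, f \notin B t].
  exists (pt f); split=> [i|t bt]; first by rewrite mxE oppr_lt0 ltr0n.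
  have /negP := fB t; apply; rewrite inE. exact/asboolP.
rewrite negb_exists => /forallP all_bad; exfalso.
have : (\sum_t m.+1 * #|B t| <= m * #|{ffun 'I_n -> 'I_m.+1}|)%N.
  by rewrite -mulnA -sum_nat_const; apply: leq_sum => t _; apply: leB.
rewrite -big_distrr /= leqNgt => /negP; apply.
rewrite (@leq_trans (m.+1 * #|{ffun 'I_n -> 'I_m.+1}|)) //.
  by rewrite ltn_mul2r ltnSn andbT; apply/card_gt0P; exists [ffun=> ord0].
rewrite leq_mul2l /= -sum1_card.
under [X in (_ <= X)%N]eq_bigr do rewrite -sum1_card big_mkcond.
rewrite exchange_big /=; apply: leq_sum => f _.
have := all_bad f; rewrite negb_forall => /existsP[t]; rewrite negbK => ft.
by rewrite (bigD1 t) //= ft.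
Qed.

End GridAvoidance.

(** * Construction of a generic negative vector [q] *)

Section GenericVector.
Local Open Scope ring_scope.
Variables (R : rcfType) (n : nat) (A : 'M[R]_n).
Implicit Types (J K : {set 'I_n}) (c : R) (q z : 'cV[R]_n).

Definition pshift J : 'M[{poly R}]_n := shift_mx (map_mx polyC A) J 'X.
Definition pdet J : {poly R} := \det (pshift J).
Definition psol q J : 'cV[{poly R}]_n := \adj (pshift J) *m map_mx polyC q.

Lemma horner_pshift J c : map_mx (horner_eval c) (pshift J) = shift_mx A J c.
Proof.
rewrite map_shift_mx; congr shift_mx; last by rewrite /= /horner_eval hornerX.
by apply/matrixP => i j; rewrite !mxE /= /horner_eval hornerC.
Qed.

Lemma horner_pdet J c : (pdet J).[c] = \det (shift_mx A J c).
Proof. by rewrite -horner_pshift det_map_mx. Qed.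

Lemma horner_psol q J c i :
  (psol q J i 0).[c] = (\adj (shift_mx A J c) *m q) i 0.
Proof.
rewrite -horner_pshift -map_mx_adj !mxE horner_sum; apply: eq_bigr => j _.
by rewrite hornerM !mxE hornerC.
Qed.

Lemma psol_solution q J c z i :
  shift_mx A J c *m z = q -> (psol q J i 0).[c] = (pdet J).[c] * z i 0.
Proof.
move=> <-; rewrite horner_psol mulmxA mul_adj_mx -horner_pdet.
by rewrite mul_scalar_mx mxE.
Qed.

Lemma pshift_psol q J : pshift J *m psol q J = pdet J *: map_mx polyC q.
Proof. by rewrite mulmxA mul_mx_adj mul_scalar_mx. Qed.

Lemma pdet_char_poly J :
  pdet J =
  char_poly (mxsub (fun i : 'I_#|J| => enum_val i) (fun j => enum_val j) A).
Proof.
rewrite /pdet det_shift /char_poly; congr determinant.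
by apply/matrixP => i j; rewrite !mxE.
Qed.

Lemma pdet_neq0 J : pdet J != 0.
Proof. by rewrite pdet_char_poly monic_neq0 // char_poly_monic. Qed.

Lemma exists_solution J c q :
  (pdet J).[c] != 0 -> exists z, shift_mx A J c *m z = q.
Proof.
rewrite horner_pdet -unitfE -[_ \is a _]/(shift_mx A J c \in unitmx) => u.
by exists (invmx (shift_mx A J c) *m q); rewrite mulKVmx.
Qed.

Lemma solution_inj J c z z' :
  (pdet J).[c] != 0 -> shift_mx A J c *m z = shift_mx A J c *m z' -> z = z'.
Proof.
rewrite horner_pdet -unitfE -[_ \is a _]/(shift_mx A J c \in unitmx) => u e.
by rewrite -(mulKmx u z) e mulKmx.
Qed.

(** Summing the rows bounds the l1-norm of the [J]-part of [z] by a quantity that decays like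
    [1 / |c|], and this norm controls the error in every row. *)
Lemma shift_large q eps : 0 < eps ->
  exists L, forall J c z, L <= `|c| -> shift_mx A J c *m z = q ->
  forall i, `|(if i \in J then c else 1) * z i 0 - q i 0| < eps.
Proof.
move=> eps0; pose a := \sum_i \sum_j `|A i j|; pose Q := \sum_i `|q i 0|.
have a0 : 0 <= a by apply: sumr_ge0 => i _; apply: sumr_ge0.
have Q0 : 0 <= Q by apply: sumr_ge0.
(* If [a * S >= eps], the summand [a * Q / eps] absorbs [Q] and the summand [a + 1] then forces
   [S <= 0], a contradiction. *)
exists (a + 1 + a * Q / eps) => J c z Lc Bz i.
pose w k := \sum_(j in J) A k j * z j 0.
pose S := \sum_(j in J) `|z j 0|; pose W := \sum_k `|w k|.
have S0 : 0 <= S by apply: sumr_ge0.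
have e k : (if k \in J then c else 1) * z k 0 = q k 0 + w k.
  by rewrite -Bz shift_mulE subrK.
rewrite e addrAC subrr add0r.
have wW : `|w i| <= W by rewrite /W (bigD1 i) //= lerDl sumr_ge0.
have WS : W <= a * S.
  apply: le_trans (_ : \sum_k \sum_(j in J) `|A k j| * `|z j 0| <= _).
    by apply: ler_sum => k _; rewrite (le_trans (ler_norm_sum _ _ _)) //;
       apply: ler_sum => j _; rewrite normrM.
  rewrite exchange_big /= mulr_sumr; apply: ler_sum => j _.
  rewrite -mulr_suml ler_wpM2r //; apply: ler_sum => k _.
  by rewrite (bigD1 j) //= lerDl sumr_ge0.
have cS : `|c| * S <= Q + a * S.
  rewrite mulr_sumr; apply: le_trans (_ : \sum_k (`|q k 0| + `|w k|) <= _); last first.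
    by rewrite big_split /= lerD2l.
  rewrite [leLHS]big_mkcond /=; apply: ler_sum => k _; case: ifPn => [kJ|_].
    by rewrite -normrM; have := e k; rewrite kJ => ->; apply: ler_normD.
  exact: addr_ge0.
rewrite (le_lt_trans wW) // (le_lt_trans WS) // ltNge; apply/negP => large.
have h1 : (a + 1 + a * Q / eps) * S <= Q + a * S.
  by apply: le_trans cS; rewrite ler_wpM2r.
have h2 : Q <= a * Q / eps * S.
  rewrite [leRHS](_ : _ = Q * (a * S / eps)); last by field; rewrite gt_eqF.
  by rewrite ler_peMr // ler_pdivlMr // mul1r.
have S_le0 : S <= 0 by lra.
have S00 : S = 0 by apply/le_anti; rewrite S_le0.
by move: large; rewrite S00 mulr0 leNgt eps0.
Qed.

(** With tolerance [|q_i|], [shift_large] excludes a zero entry [i] in the solution at a large [c]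
    beyond the roots of [pdet J]. *)
Lemma psol_neq0 q J i : q i 0 != 0 -> psol q J i 0 != 0.
Proof.
move=> qi; have [|L HL] := @shift_large q `|q i 0|; first by rewrite normr_gt0.
pose c := Num.max L (polyrcf.cauchy_bound (pdet J)).
have Dc : (pdet J).[c] != 0.
  apply: (polyrcf.ge_cauchy_bound (pdet_neq0 J)).
  by rewrite in_itv /= andbT le_max lexx orbT.
have [z Bz] := exists_solution q Dc.
apply/eqP => p0; have := psol_solution i Bz.
rewrite p0 horner0 => /esym/eqP; rewrite mulf_eq0 (negPf Dc) /= => /eqP zi.
have := HL J c z _ Bz i; rewrite zi mulr0 sub0r normrN ltxx => h; apply/notF/h.
by rewrite (le_trans _ (ler_norm _)) // le_max lexx.
Qed.

(** This bounds the bad points on a line: each one selects a root of [p], and a root comes from at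
    most one point. *)
Lemma size_le_roots (p : {poly R}) (P : R -> R -> Prop) (s : seq R) :
  p != 0 -> uniq s ->
  (forall x, x \in s -> exists c, root p c /\ P x c) ->
  (forall x y c, P x c -> P y c -> x = y) -> (size s <= size p)%N.
Proof.
move=> p0 us ex inj.
have /choice[f fP] : forall x, exists c, x \in s -> root p c /\ P x c.
  move=> x; have [/ex[c cP]|_] := boolP (x \in s); first by exists c.
  by exists 0.
rewrite -(size_map f); apply/ltnW/max_poly_roots => //.
  by apply/allP => _ /mapP[x /fP[rx _] ->].
rewrite map_inj_in_uniq // => x y /fP[_ Px] /fP[_ Py] fxy.
by apply: inj Px _; rewrite fxy.
Qed.

(** Preimages of all unit vectors would form a right inverse of a singular matrix. A missed one
    gives an axis along which each line meets the image at most once. *)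
Lemma singular_misses_delta J c :
  (pdet J).[c] = 0 ->
  exists i, forall z, shift_mx A J c *m z <> delta_mx i 0.
Proof.
move=> D0; apply: contrapT => /forallNP all_hit.
have /choice[f fP] : forall i, exists z : 'cV[R]_n, shift_mx A J c *m z = delta_mx i 0.
  by move=> i; have /existsNP[z /contrapT] := all_hit i; exists z.
have : shift_mx A J c *m (\matrix_(i, j) f j i 0) = 1%:M.
  apply/matrixP => i j; have /colP/(_ i) := fP j; rewrite !mxE eqxx andbT => <-.
  by apply: eq_bigr => k _; rewrite !mxE.
move/(congr1 determinant); rewrite det_mulmx det1 -horner_pdet D0 mul0r.
by move/esym/eqP; rewrite oner_eq0.
Qed.

Lemma set_coordB q i x y :
  set_coord q i x - set_coord q i y = (x - y) *: delta_mx i 0.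
Proof.
apply/colP => j; rewrite !mxE andbT; case: eqP => _; first by rewrite mulr1.
by rewrite subrr mulr0.
Qed.

Lemma shift_mul_delta J c i : i \notin J ->
  shift_mx A J c *m delta_mx i 0 = delta_mx i (0 : 'I_1).
Proof.
move=> iJ; apply/colP => j; rewrite -colE !mxE (negPf iJ) eqxx andbT.
by [].
Qed.

Lemma shift_mul_remove2 J c z i k :
  z i 0 = 0 -> z k 0 = 0 ->
  shift_mx A (J :\ i :\ k) c *m z = shift_mx A J c *m z.
Proof.
move=> zi zk; rewrite (@shift_mul_agree _ _ _ _ (J :\ i) _ k) //; last first.
  by move=> j jk; rewrite !inE jk.
by apply: (@shift_mul_agree _ _ _ _ _ _ i) => // j ji; rewrite !inE ji.
Qed.

Lemma generic_vector :
  exists q, [/\ forall i, q i 0 < 0,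
    forall J c z, (pdet J).[c] = 0 -> shift_mx A J c *m z <> q &
    forall J c z i k, i != k -> z i 0 = 0 -> z k 0 = 0 ->
      shift_mx A J c *m z <> q].
Proof.
pose T := ({set 'I_n} * 'I_n + {set 'I_n} * 'I_n * 'I_n)%type.
pose dir (t : T) := match t with inl (_, i) => i | inr (_, i, _) => i end.
(* In the case [inl], axis [i] is transversal to the image. In the case [inr], [i] lies outside [J],
   so moving [q] along axis [i] changes only entry [i] of [z]. *)
pose bad (t : T) q := match t with
  | inl (J, i) => exists c, [/\ (pdet J).[c] = 0,
      exists z, shift_mx A J c *m z = q &
      forall z, shift_mx A J c *m z <> delta_mx i 0]
  | inr (J, i, k) => [/\ i != k, i \notin J, q k 0 != 0 &
      exists c z, [/\ (pdet J).[c] != 0, shift_mx A J c *m z = q,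
                      z i 0 = 0 & z k 0 = 0]]
  end.
pose m1 := (\sum_J size (pdet J))%N.
(* This bounds the numerators for every [q] at once, since [q] enters them only through
   constants. *)
pose m2 := (\sum_J \sum_k \sum_j size (\adj (pshift J) k j))%N.
have size_psol q J k : (size (psol q J k 0%R) <= m2)%N.
  rewrite mxE (leq_trans (size_sum _ _ _)) //; apply/bigmax_leqP => j _.
  rewrite !mxE mulrC mul_polyC (leq_trans (size_scale_leq _ _)) //.
  rewrite /m2 (bigD1 J) //= (bigD1 k) //= (bigD1 j) //= mxE -!addnA.
  exact: leq_addr.
have [t q s us sP|q [q0 qbad]] := @grid_avoid R n T dir bad (m1 + m2).
  case: t sP => [[J i]|[[J i] k]] /= sP.
    apply: leq_trans (leq_addr _ _); rewrite /m1 (bigD1 J) //=.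
    apply: leq_trans (leq_addr _ _).
    apply: (@size_le_roots _ (fun x c =>
      (exists z, shift_mx A J c *m z = set_coord q i x) /\
      (forall z, shift_mx A J c *m z <> delta_mx i 0))) => //.
    - exact: pdet_neq0.
    - by move=> x /sP[c [D0 ez nz]]; exists c; split=> //; apply/rootP.
    - move=> x y c [[z Bz] nz] [[z' Bz'] _]; apply: contrapT => /eqP xy.
      apply: (nz ((x - y)^-1 *: (z - z'))).
      rewrite -scalemxAr mulmxBr Bz Bz' set_coordB scalerA mulVf ?scale1r //.
      by rewrite subr_eq0.
  have [->//|[x0 x0s]] : s = [::] \/ exists x0, x0 \in s.
    by case: s {us sP} => [|x s]; [left | right; exists x; rewrite mem_head].
  have [ik iJ qk _] := sP _ x0s.
  apply: leq_trans (leq_addl _ _); apply: leq_trans (size_psol (set_coord q i 0) J k).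
  apply: (@size_le_roots _ (fun x c => exists z, [/\ (pdet J).[c] != 0,
     shift_mx A J c *m z = set_coord q i x & z i 0 = 0])) => //.
  - by apply: psol_neq0; move: qk; rewrite !mxE [k == i]eq_sym (negPf ik).
  - move=> x /sP[_ _ _ [c [z [Dc Bz zi zk]]]]; exists c; split; last by exists z.
    (* Resetting entry [i] of the right-hand side to 0 keeps entry [k] of the solution at 0, so [c]
       is a root of a numerator independent of [x]. *)
    apply/rootP; rewrite (@psol_solution _ _ _ (z - x *: delta_mx i 0)).
      by rewrite !mxE zk [k == i]eq_sym (negPf ik) mulr0 subrr mulr0.
    rewrite mulmxBr Bz -scalemxAr shift_mul_delta //.
    by have := set_coordB q i x 0; rewrite subr0 => <-; rewrite subKr.
  - move=> x y c [z [Dc Bz zi]] [z' [_ Bz' zi']].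
    have : z - z' = (x - y) *: delta_mx i 0.
      apply: (solution_inj Dc).
      by rewrite mulmxBr Bz Bz' set_coordB -scalemxAr shift_mul_delta.
    move/colP/(_ i); rewrite !mxE zi zi' !eqxx mulr1 subrr => /esym/eqP.
    by rewrite subr_eq0 => /eqP.
have G1 J c z : (pdet J).[c] = 0 -> shift_mx A J c *m z <> q.
  move=> D0 Bz; have [i iP] := singular_misses_delta D0.
  by apply: (qbad (inl (J, i))); exists c; split=> //; exists z.
exists q; split=> // J c z i k ik zi zk; rewrite -(shift_mul_remove2 J c zi zk) => Bz.
apply: (qbad (inr (J :\ i :\ k, i, k))); split=> //.
- by rewrite !inE eqxx andbF.
- by rewrite lt_eqF.
- exists c, z; split=> //; apply/eqP => D0; exact: G1 D0 Bz.
Qed.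

End GenericVector.

(** * Kernel vectors arising from poles, and kernels at simple roots *)

Section Kernels.
Local Open Scope ring_scope.
Variables (R : rcfType) (n : nat).
Implicit Types (q v y z w : 'cV[R]_n) (c s e : R).

Lemma vec_root_factor (Y : 'cV[{poly R}]_n) c :
  (forall i, (Y i 0).[c] = 0) -> exists Y', Y = ('X - c%:P) *: Y'.
Proof.
move=> Y0; exists (map_mx (fun p => p %/ ('X - c%:P)) Y); apply/colP => i.
by rewrite !mxE mulrC divpK // dvdp_XsubCl; apply/rootP/Y0.
Qed.

Lemma cancel_factor (M : 'M[{poly R}]_n) (Y : 'cV[{poly R}]_n) D q c :
  M *m (('X - c%:P) *: Y) = (('X - c%:P) * D) *: map_mx polyC q ->
  M *m Y = D *: map_mx polyC q.
Proof.
rewrite -scalemxAr -scalerA => e; apply/colP => i.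
have /colP/(_ i) := e; rewrite !mxE; apply: mulfI.
by rewrite polyXsubC_eq0.
Qed.

Lemma horner_mulmx (M : 'M[{poly R}]_n) (Y : 'cV[{poly R}]_n) c :
  map_mx (horner_eval c) (M *m Y) =
  map_mx (horner_eval c) M *m map_mx (horner_eval c) Y.
Proof. exact: map_mxM. Qed.

Lemma horner_scale_const (D : {poly R}) q c :
  map_mx (horner_eval c) (D *: map_mx polyC q) = D.[c] *: q.
Proof.
by apply/colP => i; rewrite !mxE /horner_eval hornerM hornerC.
Qed.

(* If [Y / D] blows up at [c] while staying positive on one side, the leading
   coefficient of its Laurent expansion at [c] is, up to sign, [v]. *)
Lemma side_kernel (M : 'M[{poly R}]_n) (Y : 'cV[{poly R}]_n) D q c s e :
  M *m Y = D *: map_mx polyC q ->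
  (forall z, map_mx (horner_eval c) M *m z <> q) ->
  D != 0 -> D.[c] = 0 -> 0 < e ->
  (forall i t, 0 < t <= e -> 0 < (Y i 0 * D).[c + s * t]) ->
  exists v, [/\ forall i, 0 <= v i 0, v != 0 &
                map_mx (horner_eval c) M *m v = 0].
Proof.
have [m] := ubnP (size D); elim: m D Y => // m IH D Y Dm eqn miss D0 Dc e0 pos.
pose v := map_mx (horner_eval c) Y.
(* If [Y] vanishes at [c], a factor ['X - c] is cancelled from [Y] and [D]. The quotient [D'] still
   vanishes at [c], since otherwise [Y' / D'] would solve for [q] there. *)
have [v0|] := eqVneq v 0.
  have [|Y' YE] := @vec_root_factor Y c.
    by move=> i; have /colP/(_ i) := v0; rewrite !mxE.
  have [D' DE] : exists D', D = ('X - c%:P) * D'.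
    by have /factor_theorem[D' ->] := introT rootP Dc; exists D'; rewrite mulrC.
  have D'0 : D' != 0 by apply: contraNneq D0 => h; rewrite DE h mulr0.
  have eqn' : M *m Y' = D' *: map_mx polyC q.
    by apply: (@cancel_factor _ _ _ _ c); rewrite -YE eqn DE.
  have [D'c|D'c] := eqVneq D'.[c] 0; last first.
    have := congr1 (map_mx (horner_eval c)) eqn'.
    rewrite horner_mulmx horner_scale_const => h; exfalso.
    apply: (miss (D'.[c]^-1 *: map_mx (horner_eval c) Y')).
    by rewrite -scalemxAr h scalerA mulVf // scale1r.
  apply: (IH D' Y') => //.
    by rewrite DE size_mul ?polyXsubC_eq0 // size_XsubC in Dm.
  move=> i t te; have := pos i t te.
  (* The product of [Y] and [D] loses only a square, so its sign beside [c] survives. *)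
  rewrite YE DE mxE mulrACA hornerM.
  rewrite [_.[_] in X in X * _]hornerM -expr2 => h.
  rewrite -(@pmulr_rgt0 _ (('X - c%:P).[c + s * t] ^+ 2)) //.
  rewrite exprn_even_gt0 //=; apply: contraTneq h => ->.
  by rewrite expr0n mul0r ltxx.
rewrite -/v => vn0; have [i0 vi0] : exists i, v i 0 != 0.
  apply/existsP; apply: contraNT vn0 => /existsPn v0; apply/eqP/colP => i.
  by rewrite [RHS]mxE; apply/eqP; have := v0 i; rewrite negbK.
have Mv : map_mx (horner_eval c) M *m v = 0.
  by rewrite -horner_mulmx eqn horner_scale_const Dc scale0r.
have Dnz t : 0 < t <= e -> D.[c + s * t] != 0.
  by move=> /(pos i0); apply: contraTneq => D0'; rewrite hornerM D0' mulr0 ltxx.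
have Dsign t : 0 < t <= e -> (0 < D.[c + s * t]) = (0 < D.[c + s * e]).
  case/andP=> t0 te; apply: poly_sign_ray => // x /andP[tx xe].
  by rewrite Dnz // xe (lt_le_trans t0).
(* The constant sign of [D] on this side decides between [v] and [- v]. *)
have [De|De] := boolP (0 < D.[c + s * e]).
  exists v; split=> // i; rewrite mxE; apply: (poly_side_ge0 e0 (s := s)) => t te.
  by have := pos i t te; rewrite hornerM pmulr_lgt0 // Dsign.
exists (- v); split; rewrite ?oppr_eq0 ?mulmxN ?Mv ?oppr0 // => i.
rewrite !mxE -hornerN; apply: (poly_side_ge0 e0 (s := s)) => t te.
have := pos i t te; rewrite hornerM hornerN oppr_gt0 nmulr_lgt0 //.
by rewrite lt_neqAle Dnz //= leNgt Dsign.
Qed.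

Lemma kernel_det0 (B : 'M[R]_n) y : B *m y = 0 -> y != 0 -> \det B = 0.
Proof.
move=> By; apply: contraNeq; rewrite -unitfE -[_ \is a _]/(B \in unitmx) => u.
by rewrite -(mulKmx u y) By mulmx0.
Qed.

(** Replacing column [k] of [B] by [w] keeps [y] in the kernel, because [y k 0 = 0]. The
    determinant, now zero, expands along that column into the entry in question. *)
Lemma adj_row_kernel (B : 'M[R]_n) y k w :
  B *m y = 0 -> y != 0 -> y k 0 = 0 -> (\adj B *m w) k 0 = 0.
Proof.
move=> By y0 yk; pose B' := \matrix_(i, j) if j == k then w i 0 else B i j.
have B'y : B' *m y = 0.
  rewrite -By; apply/colP => i; rewrite !mxE; apply: eq_bigr => j _; rewrite mxE.
  by case: eqP => // ->; rewrite yk !mulr0.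
have /matrixP/(_ k k) := mul_adj_mx B'.
rewrite [RHS]mxE eqxx (kernel_det0 B'y y0) mul0rn => <-; rewrite !mxE.
apply: eq_bigr => j _.
rewrite !mxE eqxx /cofactor; congr (_ * determinant _ * _).
by apply/matrixP => a b; rewrite !mxE eq_sym (negPf (neq_lift _ _)).
Qed.

Variable A : 'M[R]_n.

(** With [x] the [J]-part of [v], [B_J(t) v = (t - c) x]. Applying the adjugate and cancelling
    [t - c] gives [adj(B_J(t)) x = D'(t) v] with [D'(c)] nonzero. At [c], [adj_row_kernel] kills
    entry [k] of the left side if [y] is not 0. *)
Lemma simple_root_kernel J c v y k :
  mup c (pdet A J) = 1%N ->
  shift_mx A J c *m v = 0 -> shift_mx A J c *m y = 0 ->
  v k 0 != 0 -> y k 0 = 0 -> y = 0.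
Proof.
move=> m1 Bv By vk yk; apply/eqP; apply: contraT => y0.
pose x : 'cV[R]_n := \col_i (if i \in J then v i 0 else 0).
have ev : pshift A J *m map_mx polyC v = ('X - c%:P) *: map_mx polyC x.
  apply/colP => i; rewrite shift_mulE !mxE.
  have /colP/(_ i) := Bv; rewrite shift_mulE mxE => /eqP; rewrite subr_eq0 => /eqP h.
  under eq_bigr do rewrite !mxE -polyCM.
  rewrite -rmorph_sum /= -h; case: ifP => _; last by rewrite !mul1r subrr mulr0.
  by rewrite polyCM mulrBl.
have := congr1 (mulmx (\adj (pshift A J))) ev.
rewrite mulmxA mul_adj_mx mul_scalar_mx -scalemxAr -/(pdet A J).
have [D' DE D'c] := simple_root_factor (pdet_neq0 A J) m1.
rewrite DE -scalerA => /colP/(_ k); rewrite !mxE => /mulfI.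
rewrite polyXsubC_eq0 => /(_ isT)/(congr1 (horner^~ c)).
rewrite hornerM hornerC => h.
have := @adj_row_kernel _ y k x By y0 yk; rewrite -horner_psol mxE -h => /eqP.
by rewrite mulf_eq0 (negPf D'c) (negPf vk).
Qed.

End Kernels.

(** * Solving supports far out and across one critical value *)

Section Crossing.
Local Open Scope ring_scope.
Variables (R : rcfType) (n : nat) (A : 'M[R]_n) (q : 'cV[R]_n).
Implicit Types (J K : {set 'I_n}) (c t : R) (z v : 'cV[R]_n).

Hypothesis n_gt0 : (0 < n)%N.
Hypothesis q_lt0 : forall i, q i 0 < 0.
Hypothesis missed : forall J c z,
  (pdet A J).[c] = 0 -> shift_mx A J c *m z <> q.
Hypothesis one_zero : forall J c z i k, i != k -> z i 0 = 0 -> z k 0 = 0 ->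
  shift_mx A J c *m z <> q.

(* By Cramer's rule, away from the zeros of [pdet A J] this has the sign of entry
   [i] of the solution. *)
Definition coord_sign J i : {poly R} := psol A q J i 0 * pdet A J.
Definition solves J t := [forall i, 0 < (coord_sign J i).[t]].
Definition parity t := odd #|[set J | solves J t]|.

Lemma coord_sign_neq0 J i : coord_sign J i != 0.
Proof. by rewrite mulf_neq0 ?pdet_neq0 ?psol_neq0 // lt_eqF. Qed.

Lemma coord_sign_solution J c z i : shift_mx A J c *m z = q ->
  (coord_sign J i).[c] = (pdet A J).[c] ^+ 2 * z i 0.
Proof.
by move=> Bz; rewrite hornerM (psol_solution i Bz) mulrAC -expr2.
Qed.

Lemma solves_solution J c z : (pdet A J).[c] != 0 -> shift_mx A J c *m z = q ->
  forall i, (0 < (coord_sign J i).[c]) = (0 < z i 0).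
Proof.
move=> Dc Bz i; rewrite (coord_sign_solution i Bz) pmulr_rgt0 //.
by rewrite exprn_even_gt0.
Qed.

(** Far out, [t * z_i] for [i] in [J] and [z_i] for the other [i] are close to [q_i], hence
    negative. For [t > 0] no entry is positive; for [t < 0] the positive ones are those in [J]. *)
Lemma parity_ends : exists L, forall a b,
  a <= - L -> L <= b ->
  (forall J, (pdet A J).[a] != 0) -> (forall J, (pdet A J).[b] != 0) ->
  parity a (+) parity b.
Proof.
have [eps eps0 epsP] := seq_isolate [seq q i 0 | i : 'I_n] 0.
have [L LP] := shift_large A q eps0.
exists (Num.max L 1) => a b aL bL Da Db.
have {}epsP i : eps < - q i 0.
  have := epsP (q i 0) (codom_f _ i); rewrite subr0 lt_eqF // ltr0_norm //.
  exact.
have b0 : 0 < b by apply: lt_le_trans bL; rewrite lt_max ltr01 orbT.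
have a0 : a < 0.
  by apply: le_lt_trans aL _; rewrite oppr_lt0 lt_max ltr01 orbT.
have Lb : L <= `|b|.
  by rewrite gtr0_norm //; apply: le_trans bL; rewrite le_max lexx.
have La : L <= `|a|.
  rewrite ltr0_norm // lerNr; apply: le_trans aL _.
  by rewrite lerN2 le_max lexx.
have neg J c z i : L <= `|c| -> shift_mx A J c *m z = q ->
    (if i \in J then c else 1) * z i 0 < 0.
  move=> Lc Bz; have := LP J c z Lc Bz i; have := epsP i.
  by rewrite ltr_norml => h1 /andP[_ h2]; lra.
have solb J : solves J b = false.
  have [z Bz] := exists_solution q (Db J).
  apply/negP => /forallP/(_ (Ordinal n_gt0)).
  rewrite (solves_solution (Db J) Bz) => z0.
  have := neg J b z (Ordinal n_gt0) Lb Bz.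
  by case: ifP => _; rewrite pmulr_rlt0 // lt_gtF.
have sola J : solves J a = (J == [set: 'I_n]).
  have [z Bz] := exists_solution q (Da J).
  have neg' i := neg J a z i La Bz.
  apply/forallP/eqP => [pos|JT i].
    apply/setP => i; rewrite finset.in_setT; have := neg' i; case: ifP => // _.
    by rewrite mul1r lt_gtF // -(solves_solution (Da J) Bz).
  rewrite (solves_solution (Da J) Bz); have := neg' i.
  by rewrite JT finset.in_setT nmulr_rlt0.
rewrite /parity; under eq_finset do rewrite sola.
under [X in _ (+) odd #|pred_of_set X|]eq_finset do rewrite solb.
have -> : [set J | J == [set: 'I_n]] = [set [set: 'I_n]].
  by apply/setP => J; rewrite !inE.
by rewrite cards1 (_ : [set _ | _] = finset.set0) ?cards0 //; apply/setP => J; rewrite !inE.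
Qed.

Section AtCriticalValue.
Variables (c e : R).
Hypothesis e_gt0 : 0 < e.
Hypothesis no_root : forall J i t, t != c -> c - e <= t <= c + e ->
  (coord_sign J i).[t] != 0.

Lemma coord_sign_ray J i s t : s = 1 \/ s = -1 -> 0 < t <= e ->
  (coord_sign J i).[c + s * t] != 0.
Proof.
move=> s1 /andP[t0 te]; apply: no_root; last by case: s1 => ->; lra.
rewrite -subr_eq0 addrAC subrr add0r mulf_neq0 //; last by rewrite gt_eqF.
by case: s1 => ->; rewrite ?oppr_eq0 oner_eq0.
Qed.

Lemma pole_kernel J s : s = 1 \/ s = -1 ->
  (pdet A J).[c] = 0 -> solves J (c + s * e) ->
  exists v, [/\ forall i, 0 <= v i 0, v != 0 & shift_mx A J c *m v = 0].
Proof.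
move=> s1 Dc /forallP pos; rewrite -horner_pshift.
apply: (@side_kernel _ _ _ (psol A q J) (pdet A J) q _ s e) => //.
- exact: pshift_psol.
- by move=> z; rewrite horner_pshift; apply: missed.
- exact: pdet_neq0.
move=> i t /andP[t0 te]; rewrite -/(coord_sign J i).
rewrite (@poly_sign_ray _ _ _ _ t e) // => x /andP[tx xe].
by apply: coord_sign_ray => //; rewrite xe (lt_le_trans t0).
Qed.

(** The numerators at [c] form a kernel vector, hence equal [k v] with one constant [k], nonzero
    because the singular system misses [q]. So each [coord_sign] is [t - c] times a factor with the
    sign of [k D'(c)], and all signs flip together. *)
Lemma regular_pole J v : mup c (pdet A J) = 1%N ->
  (forall i, 0 < v i 0) -> shift_mx A J c *m v = 0 ->
  solves J (c - e) (+) solves J (c + e).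
Proof.
move=> m1 v0 Bv; pose i0 := Ordinal n_gt0.
have [D' DE D'c] := simple_root_factor (pdet_neq0 A J) m1.
have Dc : (pdet A J).[c] = 0 by rewrite DE hornerM hornerXsubC subrr mul0r.
pose y := map_mx (horner_eval c) (psol A q J).
have By : shift_mx A J c *m y = 0.
  by rewrite -horner_pshift -horner_mulmx pshift_psol horner_scale_const Dc scale0r.
pose k := y i0 0 / v i0 0.
have yE i : (psol A q J i 0).[c] = k * v i 0.
  have vi0 := v0 i0.
  have := simple_root_kernel (y := y - k *: v) (k := i0) m1 Bv.
  rewrite mulmxBr -scalemxAr Bv By scaler0 subr0 gt_eqF // => /(_ erefl isT).
  have -> : (y - k *: v) i0 0 = 0 by rewrite /k !mxE divfK ?subrr //; rewrite gt_eqF.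
  by move=> /(_ erefl)/colP/(_ i); rewrite !mxE => /eqP; rewrite subr_eq0 => /eqP.
have k0 : k != 0.
  apply/eqP => k0; have [|Y' YE] := @vec_root_factor _ _ (psol A q J) c.
    by move=> i; rewrite yE k0 mul0r.
  have eqn' : pshift A J *m Y' = D' *: map_mx polyC q.
    by apply: (@cancel_factor _ _ _ _ _ _ c); rewrite -YE pshift_psol DE.
  have := congr1 (map_mx (horner_eval c)) eqn'.
  rewrite horner_mulmx horner_scale_const horner_pshift => h.
  apply: (missed Dc (z := D'.[c]^-1 *: map_mx (horner_eval c) Y')).
  by rewrite -scalemxAr h scalerA mulVf // scale1r.
pose g i := psol A q J i 0 * D'.
have FE i t : (coord_sign J i).[t] = (t - c) * (g i).[t].
  by rewrite /coord_sign DE mulrCA hornerM hornerXsubC.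
have gc i : (0 < (g i).[c]) = (0 < k * D'.[c]).
  by rewrite hornerM yE mulrAC pmulr_lgt0.
have gc0 i : (g i).[c] != 0.
  rewrite hornerM yE; apply: mulf_neq0 => //; apply: mulf_neq0 => //.
  exact: lt0r_neq0.
have gray s i : s = 1 \/ s = -1 -> (0 < (g i).[c + s * e]) = (0 < k * D'.[c]).
  move=> s1; have <- : (0 < (g i).[c + s * 0]) = (0 < k * D'.[c]).
    by rewrite mulr0 addr0 gc.
  apply/esym.
  apply: poly_sign_ray => [|t]; first exact: ltW.
  rewrite le_eqVlt => /andP[/predU1P[<-|t0] te]; first by rewrite mulr0 addr0.
  have : (coord_sign J i).[c + s * t] != 0 by rewrite coord_sign_ray // t0.
  by apply: contraNneq; rewrite FE => ->; rewrite mulr0.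
have gr i : (0 < (g i).[c + e]) = (0 < k * D'.[c]).
  by rewrite -[e]mul1r gray //; left.
have gl i : (0 < (g i).[c - e]) = (0 < k * D'.[c]).
  by rewrite -mulN1r gray //; right.
have gl0 i : (g i).[c - e] != 0.
  have := @coord_sign_ray J i (-1) e.
  rewrite mulN1r e_gt0 lexx => /(_ (or_intror erefl) isT).
  by apply: contraNneq; rewrite FE => ->; rewrite mulr0.
have sr : solves J (c + e) = (0 < k * D'.[c]).
  have F i : (0 < (coord_sign J i).[c + e]) = (0 < k * D'.[c]).
    by rewrite FE addrAC subrr add0r pmulr_rgt0.
  by apply/forallP/idP => [/(_ i0)|h i]; rewrite F.
have sl : solves J (c - e) = ~~ (0 < k * D'.[c]).
  have F i : (0 < (coord_sign J i).[c - e]) = ~~ (0 < k * D'.[c]).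
    rewrite FE addrAC subrr add0r nmulr_rgt0 ?oppr_lt0 // -(gl i).
    by rewrite -leNgt le_eqVlt (negPf (gl0 i)).
  by apply/forallP/idP => [/(_ i0)|h i]; rewrite F.
by rewrite sl sr addNb addbb.
Qed.

Definition toggle (i : 'I_n) J : {set 'I_n} := [set j | (j \in J) (+) (j == i)].

Lemma toggle_involutive i : involutive (toggle i).
Proof. by move=> J; apply/setP => j; rewrite !inE -addbA addbb addbF. Qed.

Lemma toggle_neq i J : toggle i J != J.
Proof.
by apply/eqP => /setP/(_ i); rewrite !inE eqxx addbT; case: (i \in J).
Qed.

Lemma toggle_agree i J j : j != i -> (j \in J) = (j \in toggle i J).
Proof. by move=> /negPf ji; rewrite inE ji addbF. Qed.

Lemma pdet_sign_crossing J : (pdet A J).[c] != 0 ->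
  (0 < (pdet A J).[c - e]) = (0 < (pdet A J).[c + e]).
Proof.
move=> Dc; have e0 := e_gt0; apply: poly_sign_itv => [|t te]; first lra.
have [->//|tc] := eqVneq t c.
have := no_root J (Ordinal n_gt0) tc te; apply: contraNneq => D0.
by rewrite hornerM D0 mulr0.
Qed.

Lemma coord_sign_crossing J i t : (coord_sign J i).[c] != 0 ->
  c - e <= t <= c + e ->
  (0 < (coord_sign J i).[t]) = (0 < (coord_sign J i).[c]).
Proof.
move=> Fc /andP[lt tr].
have nz x : c - e <= x <= c + e -> (coord_sign J i).[x] != 0.
  by move=> xe; have [->//|xc] := eqVneq x c; apply: no_root.
have h x : c - e <= x <= c + e ->
    (0 < (coord_sign J i).[c - e]) = (0 < (coord_sign J i).[x]).
  move=> /andP[lx xr]; apply: poly_sign_itv => // y /andP[ly yx].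
  by rewrite nz // ly (le_trans yx).
by rewrite -!h //; lra.
Qed.

(* At a zero of coordinate [i], the supports [J] and [toggle i J] share the same
   solution, and their coordinate-[i] numerators coincide as polynomials. *)
Lemma solves_toggle J z i : (pdet A J).[c] != 0 -> shift_mx A J c *m z = q ->
  z i 0 = 0 ->
  solves J (c - e) (+) solves J (c + e) =
  solves (toggle i J) (c - e) (+) solves (toggle i J) (c + e).
Proof.
move=> Dc Bz zi; have e0 := e_gt0; pose K := toggle i J.
have BKz : shift_mx A K c *m z = q.
  rewrite -Bz; apply: (@shift_mul_agree _ _ _ _ _ _ i) => // j ji.
  by rewrite -toggle_agree.
have DKc : (pdet A K).[c] != 0 by apply/eqP => /missed/(_ BKz).
have zj j : j != i -> z j 0 != 0.
  by move=> ji; apply/eqP => zj; apply: one_zero ji zj zi Bz.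
pose rest := [forall (j | j != i), 0 < z j 0].
have main H t : H = J \/ H = K -> (t = c - e) \/ (t = c + e) ->
    solves H t = rest && ((0 < (psol A q J i 0).[t]) == (0 < (pdet A H).[t])).
  move=> HJK tce.
  have [DHc BHz] : (pdet A H).[c] != 0 /\ shift_mx A H c *m z = q.
    by case: HJK => ->.
  have tin : c - e <= t <= c + e by case: tce => ->; lra.
  have tnc : t != c by case: tce => ->; apply/negbT; [apply: lt_eqF | apply: gt_eqF]; lra.
  have Fj j : j != i -> (0 < (coord_sign H j).[t]) = (0 < z j 0).
    move=> ji; rewrite coord_sign_crossing // ?(solves_solution DHc BHz) //.
    by rewrite (coord_sign_solution j BHz) mulf_neq0 ?sqrf_eq0 ?zj // expf_neq0.
  have Fi : (0 < (coord_sign H i).[t]) =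
      ((0 < (psol A q J i 0).[t]) == (0 < (pdet A H).[t])).
    have -> : psol A q J i 0 = psol A q H i 0.
      by case: HJK => -> //; apply: adj_shift_row => j; apply: toggle_agree.
    have := no_root H i tnc tin; rewrite hornerM mulf_eq0 negb_or => /andP[p0 D0].
    case: (ltrgt0P (psol A q H i 0).[t]) p0 => // ps _.
      by rewrite pmulr_rgt0.
    rewrite nmulr_rgt0 //; case: (ltrgt0P _) D0 => //.
  apply/forallP/andP => [pos|[/forall_inP r F] j].
    by split; [apply/forall_inP => j ji; rewrite -Fj | rewrite -Fi].
  by have [->|ji] := eqVneq j i; rewrite ?Fi // Fj // r.
rewrite !main; [| by [left|right] ..].
(* Neither determinant changes sign at [c], so either support flips exactly when [rest] holds and
   the shared numerator changes sign. *)
have DJ := pdet_sign_crossing Dc; have DK := pdet_sign_crossing DKc.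
rewrite DJ -/K DK; case: (rest) => //=.
by case: (0 < (psol A q J i 0).[c - e]); case: (0 < (psol A q J i 0).[c + e]);
   case: (0 < (pdet A J).[c + e]); case: (0 < (pdet A K).[c + e]).
Qed.

Let flipped := [set J | solves J (c - e) (+) solves J (c + e)].

Lemma parity_flipped : parity (c - e) (+) parity (c + e) = odd #|flipped|.
Proof.
rewrite /parity; set X := [set J | _]; set Y := [set J | solves J (c + e)].
have -> : flipped = (X :\: Y) :|: (Y :\: X).
  by apply/setP => J; rewrite !inE; do 2 case: (solves J _).
rewrite cardsU (_ : _ :&: _ = finset.set0) ?cards0 ?subn0; last first.
  by apply/setP => J; rewrite !inE; do 2 case: (solves J _).
rewrite -(cardsID Y X) -(cardsID X Y) !oddD (finset.setIC Y X).
by case: (odd _); case: (odd _); case: (odd _).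
Qed.

(** Away from poles, a flip needs a vanishing entry of the solution, unique by [one_zero]; toggling
    it pairs off the flipping supports. *)
Lemma odd_flipped_nonpole :
  odd #|flipped :\: [set J | (pdet A J).[c] == 0]| = false.
Proof.
(* Reading the vanishing entry off [psol] makes [f] independent of a solution; the fallback [J] is
   not reached on the set considered. *)
pose f J := if [pick i | (psol A q J i 0).[c] == 0] is Some i then toggle i J else J.
apply: (@odd_card_involution _ f) => J; rewrite !inE => /andP[Dc flip].
have e0 := e_gt0; have [z Bz] := exists_solution q Dc.
have [i zi] : exists i, z i 0 = 0.
  apply: contrapT => /forallNP nz; move: flip.
  have F i t : c - e <= t <= c + e ->
      (0 < (coord_sign J i).[t]) = (0 < (coord_sign J i).[c]).
    apply: coord_sign_crossing; rewrite (coord_sign_solution i Bz).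
    by rewrite mulf_neq0 ?expf_neq0 //; apply/eqP/nz.
  have S t : c - e <= t <= c + e -> solves J t = solves J c.
    by move=> te; apply: eq_forallb => i; rewrite F.
  by rewrite !S ?addbb //; lra.
have fE K : (pdet A K).[c] != 0 -> shift_mx A K c *m z = q -> f K = toggle i K.
  move=> DK BKz; rewrite /f; case: pickP => [j|/(_ i)].
    rewrite (psol_solution j BKz) mulf_eq0 (negPf DK) /= => /eqP zj.
    have [->//|ji] := eqVneq j i; by case: (one_zero ji zj zi BKz).
  by rewrite (psol_solution i BKz) zi mulr0 eqxx.
have BKz : shift_mx A (toggle i J) c *m z = q.
  rewrite -Bz; apply: (@shift_mul_agree _ _ _ _ _ _ i) => // j ji.
  by rewrite -toggle_agree.
have DKc : (pdet A (toggle i J)).[c] != 0 by apply/eqP => /missed/(_ BKz).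
rewrite (fE J Dc Bz) (fE _ DKc BKz) toggle_involutive toggle_neq; split=> //.
by rewrite DKc -(solves_toggle Dc Bz zi) flip.
Qed.

Lemma parity_no_kernel :
  (forall J v, (forall i, 0 <= v i 0) -> shift_mx A J c *m v = 0 -> v = 0) ->
  parity (c - e) (+) parity (c + e) = false.
Proof.
move=> no_ker; rewrite parity_flipped.
rewrite -(cardsID [set J | (pdet A J).[c] == 0]) oddD odd_flipped_nonpole addbF.
rewrite (_ : _ :&: _ = finset.set0) ?cards0 //; apply/setP => J; rewrite !inE.
apply/negP => /andP[flip /eqP Dc].
have nosol s : s = 1 \/ s = -1 -> solves J (c + s * e) = false.
  move=> s1; apply/negP => /(pole_kernel s1 Dc)[v [v0 vn0 Bv]].
  by rewrite (no_ker J v) // eqxx in vn0.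
have := nosol (-1) (or_intror erefl); have := nosol 1 (or_introl erefl).
by rewrite mul1r mulN1r => r l; rewrite l r in flip.
Qed.

(** The nonsingular supports pair off; among the singular ones [pole_kernel] leaves only [J0], which
    flips by [regular_pole]. *)
Lemma parity_regular_pole J0 v0 : mup c (pdet A J0) = 1%N ->
  (forall i, 0 < v0 i 0) -> shift_mx A J0 c *m v0 = 0 ->
  (forall J v, (forall i, 0 <= v i 0) -> v != 0 -> shift_mx A J c *m v = 0 ->
     J = J0) ->
  parity (c - e) (+) parity (c + e).
Proof.
move=> m1 v0pos Bv0 uniqJ; rewrite parity_flipped.
rewrite -(cardsID [set J | (pdet A J).[c] == 0]) oddD odd_flipped_nonpole addbF.
rewrite (_ : _ :&: _ = [set J0]) ?cards1 //; apply/setP => J; rewrite !inE.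
apply/andP/eqP => [[flip /eqP Dc]|->]; last first.
  split; first exact: regular_pole m1 v0pos Bv0.
  by rewrite -/(root _ _) -dvdp_XsubCl XsubC_dvd ?pdet_neq0 // m1.
have onside s : s = 1 \/ s = -1 -> solves J (c + s * e) -> J = J0.
  by move=> s1 /(pole_kernel s1 Dc)[v [vge0 vn0 Bv]]; apply: uniqJ Bv.
have [l|nl] := boolP (solves J (c - e)).
  by apply: (onside (-1)); [right | rewrite mulN1r].
move: flip; rewrite (negPf nl) /= => r.
by apply: (onside 1); [left | rewrite mul1r].
Qed.

End AtCriticalValue.

End Crossing.

(** * The parity count along the whole line *)

Section OddCount.
Local Open Scope ring_scope.

(** The list [S] holds all roots of all [coord_sign] polynomials. The parity jumps at a point of [S]
    exactly when [P] holds there, and [parity_ends] makes the total odd. *)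
Lemma odd_regular_count (R : rcfType) n (A : 'M[R]_n) (P : R -> bool) :
  (0 < n)%N ->
  (forall c, P c -> exists J (v : 'cV_n),
     [/\ mup c (pdet A J) = 1%N, forall i, 0 < v i 0, shift_mx A J c *m v = 0 &
         forall K (w : 'cV_n), (forall i, 0 <= w i 0) -> w != 0 ->
           shift_mx A K c *m w = 0 -> K = J]) ->
  (forall c, ~~ P c -> forall J (v : 'cV_n), (forall i, 0 <= v i 0) ->
     shift_mx A J c *m v = 0 -> v = 0) ->
  exists S, [/\ uniq S, forall c, P c -> c \in S & odd (count P S)].
Proof.
move=> n0 regular nonpole; have [q [q_lt0 missed one_zero]] := generic_vector A.
pose G := \prod_J \prod_i coord_sign A q J i.
have G0 : G != 0.
  by apply/prodf_neq0 => J _; apply/prodf_neq0 => i _; apply: coord_sign_neq0.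
pose S := polyrcf.rootsR G.
have SP t : (t \in S) = root G t.
  by have := polyrcf.roots_on_rootsR G0 t; rewrite in_itv.
have GF J i t : root (coord_sign A q J i) t -> t \in S.
  rewrite SP /root /G (bigD1 J) //= (bigD1 i) //= !hornerM => /eqP ->.
  by rewrite !mul0r.
have GD J t : (pdet A J).[t] = 0 -> t \in S.
  move=> Dt; apply: (GF J (Ordinal n0)).
  by rewrite /root hornerM Dt mulr0.
have PS c : P c -> c \in S.
  case/regular => J [v [m1 _ _ _]]; apply: (GD J); apply/rootP.
  by rewrite -dvdp_XsubCl XsubC_dvd ?pdet_neq0 // m1.
exists S; split=> //; first by apply: lt_sorted_uniq; apply: polyrcf.sorted_roots.
have [L LP] := parity_ends A n0 q_lt0.
(* [b] reaches the threshold of [parity_ends] and exceeds all roots of [G] in absolute value. *)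
pose C := polyrcf.cauchy_bound G; pose b := Num.max L C.
have CS t : t \in S -> - b < t < b.
  rewrite SP => /rootP/(polyrcf.cauchy_boundP G0); rewrite -ltr_norml => h.
  by apply: lt_le_trans h _; rewrite le_max lexx orbT.
have notS t : ~~ (- b < t < b) -> forall J, (pdet A J).[t] != 0.
  by move=> nt J; apply: contra nt => /eqP/GD/CS.
rewrite -(@parity_sweep _ (parity A q) P S (- b) b).
- apply: LP; rewrite ?lerN2 ?le_max ?lexx //; apply: notS; rewrite ltxx ?andbF //.
- rewrite rcons_path; apply/andP; split.
    rewrite path_min_sorted; first exact: polyrcf.sorted_roots.
    by apply/allP => t /CS/andP[].
  have b0 : 0 < b by rewrite lt_max polyrcf.cauchy_bound_gt0 orbT.
  have := mem_last (- b) S; rewrite inE => /predU1P[->|/CS/andP[] //].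
  by lra.
- move=> x y _ xy _ noS; congr (odd #|pred_of_set _|); apply/setP => J; rewrite !inE.
  apply: eq_forallb => i; apply: poly_sign_itv => [|t /noS]; first exact: ltW.
  by apply: contra => /GF.
move=> c cS; have [e e0 eP] := seq_isolate S c; exists e => // d /andP[d0 de].
have no_root J i t : t != c -> c - d <= t <= c + d -> (coord_sign A q J i).[t] != 0.
  move=> tc tcd; apply/negP => /GF/eP/(_ tc); apply/negP; rewrite -leNgt.
  by rewrite (le_trans _ de) // ler_norml; lra.
have [Pc|nPc] := boolP (P c).
  have [J [v [m1 v0 Bv uJ]]] := regular c Pc.
  exact: (parity_regular_pole n0 missed one_zero d0 no_root m1 v0 Bv uJ).
exact: (parity_no_kernel n0 missed one_zero d0 no_root (nonpole c nPc)).
Qed.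

End OddCount.

(** * Nonnegative kernel vectors, productions and Pareto eigenvalues *)

Section ParetoKernel.
Local Open Scope ring_scope.
Variables (R : realType) (n : nat) (A : 'M[R]_n).
Implicit Types (J : {set 'I_n}) (c : R) (v : 'cV[R]_n).

Lemma shift_kernelP J c v :
  shift_mx A J c *m v = 0 <->
  forall i, (if i \in J then c else 1) * v i 0 = \sum_(j in J) A i j * v j 0.
Proof.
split=> [/colP Bv i|e].
  by have := Bv i; rewrite shift_mulE mxE => /eqP; rewrite subr_eq0 => /eqP.
by apply/colP => i; rewrite shift_mulE e subrr mxE.
Qed.

Lemma setmx_mul (I J : {set 'I_n}) (u : 'cV[R]_#|J|) v i :
  (forall j, u j 0 = v (enum_val j) 0) ->
  (setmx A I J *m u) i 0 = \sum_(j in J) A (enum_val i) j * v j 0.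
Proof.
move=> uv; rewrite mxE [RHS]big_enum_val /=; apply: eq_bigr => j _.
by rewrite !mxE uv.
Qed.

Lemma sum_positive_part J v i : (forall j, 0 <= v j 0) ->
  \sum_(j in [set j in J | 0 < v j 0]) A i j * v j 0 =
  \sum_(j in J) A i j * v j 0.
Proof.
move=> v0; rewrite [RHS](bigID (fun j => 0 < v j 0)) /= [X in _ = _ + X]big1.
  by rewrite addr0; apply: eq_bigl => j; rewrite inE.
by move=> j /andP[_]; rewrite lt_neqAle v0 andbT negbK => /eqP <-; rewrite mulr0.
Qed.

Lemma kernel_support_neq0 J c v : (forall i, 0 <= v i 0) -> v != 0 ->
  shift_mx A J c *m v = 0 -> [set j in J | 0 < v j 0] != finset.set0.
Proof.
move=> v0 vn0 /shift_kernelP Bv; apply: contra vn0 => /eqP K0.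
have s0 i : \sum_(j in J) A i j * v j 0 = 0.
  by rewrite -sum_positive_part // K0 big_set0.
apply/eqP/colP => i; rewrite mxE; have := Bv i; rewrite s0.
case: ifPn => [iJ _|_]; last by rewrite mul1r.
have : i \notin [set j in J | 0 < v j 0] by rewrite K0 finset.in_set0.
by rewrite inE iJ lt_neqAle v0 andbT negbK => /eqP.
Qed.

(** The [J]-part of [v] is the eigenvector and the other entries are the slacks. Indices of [J]
    where [v] vanishes leave the support with slack 0. *)
Lemma kernel_produces J c v : (forall i, 0 <= v i 0) -> v != 0 ->
  shift_mx A J c *m v = 0 -> produces A [set j in J | 0 < v j 0] c.
Proof.
move=> v0 vn0 Bv; have K0 := kernel_support_neq0 v0 vn0 Bv.
move/shift_kernelP: Bv => Bv; set K := [set j in J | _]; split=> //.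
pose u : 'cV[R]_#|K| := \col_j v (enum_val j) 0.
have uv j : u j 0 = v (enum_val j) 0 by rewrite mxE.
exists u; split; first split.
- apply/colP => i; rewrite (setmx_mul _ uv) sum_positive_part // -Bv mxE uv.
  by have := enum_valP i; rewrite inE => /andP[-> _].
- by move=> i; rewrite uv; have := enum_valP i; rewrite inE => /andP[].
move=> i; rewrite (setmx_mul _ uv) sum_positive_part // -Bv.
have := enum_valP i; rewrite !inE; case: ifP => _ /=; last by rewrite mul1r.
by rewrite lt_neqAle v0 andbT negbK => /eqP <-; rewrite mulr0.
Qed.

(** The [J]-part of [v] and the slack outside [J] have disjoint supports, whence complementarity. *)
Lemma kernel_pareto J c v : (forall i, 0 <= v i 0) -> v != 0 ->
  shift_mx A J c *m v = 0 -> pareto_eigenvalue A c.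
Proof.
move=> v0 vn0 Bv; have K0 := kernel_support_neq0 v0 vn0 Bv.
move/shift_kernelP: Bv => Bv.
pose x : 'cV[R]_n := \col_i (if i \in J then v i 0 else 0).
have wE i : (A *m x - c *: x) i 0 = if i \in J then 0 else v i 0.
  have -> : (A *m x - c *: x) i 0 = \sum_(j in J) A i j * v j 0 - c * x i 0.
    rewrite !mxE [in RHS]big_mkcond /=; congr (_ - _); apply: eq_bigr => j _.
    by rewrite mxE; case: ifP; rewrite ?mulr0.
  rewrite -Bv mxE; case: ifP => _; first by rewrite subrr.
  by rewrite mulr0 subr0 mul1r.
exists x; split.
- apply: contra K0 => /eqP x0; apply/eqP/setP => j; rewrite !inE.
  apply/negP => /andP[jJ]; have /colP/(_ j) := x0; rewrite !mxE jJ => ->.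
  by rewrite ltxx.
- by move=> i; rewrite mxE; case: ifP.
- by move=> i; rewrite wE; case: ifP.
by rewrite /dotcv big1 // => i _; rewrite wE mxE; case: ifP; rewrite ?mulr0 ?mul0r.
Qed.

(** The eigenvector is extended outside [J] by the slacks [A_{J^c,J} u], which regularity makes
    positive. *)
Lemma regular_kernel J c : regular_production A J c ->
  mup c (pdet A J) = 1%N /\
  exists v, (forall i, 0 < v i 0) /\ shift_mx A J c *m v = 0.
Proof.
case=> simple [u [[Au u0] wpos]]; split; first by rewrite pdet_char_poly.
pose x : 'cV[R]_n := \col_i \sum_(j : 'I_#|J|) (if enum_val j == i then u j 0 else 0).
have ux j : u j 0 = x (enum_val j) 0.
  rewrite mxE (bigD1 j) //= eqxx big1 ?addr0 // => k /negPf kj.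
  by rewrite (inj_eq enum_val_inj) kj.
pose v : 'cV[R]_n := \col_i if i \in J then x i 0 else \sum_(j in J) A i j * x j 0.
have xv i : \sum_(j in J) A i j * v j 0 = \sum_(j in J) A i j * x j 0.
  by apply: eq_bigr => j jJ; rewrite [v j 0]mxE jJ.
exists v; split=> [i|].
  rewrite mxE; case: ifPn => iJ.
    by rewrite -(enum_rankK_in iJ iJ) -ux.
  have iJ' : i \in ~: J by rewrite inE.
  by have := wpos (enum_rank_in iJ' i); rewrite (setmx_mul _ ux) enum_rankK_in.
apply/shift_kernelP => i; rewrite xv [v i 0]mxE; case: ifPn => iJ.
  have /colP/(_ (enum_rank_in iJ i)) := Au.
  by rewrite (setmx_mul _ ux) mxE ux enum_rankK_in.
by rewrite mul1r.
Qed.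

(* The support [K] of the [J]-part of a nonnegative kernel vector [w] of
   [shift_mx A J c] produces [c]; [w] is also in the kernel of [shift_mx A K c],
   where regularity makes it strictly positive, so [J] is not larger than [K]. *)
Lemma regular_kernel_support (n_gt0 : (0 < n)%N) J c :
  unique (fun K : {set 'I_n} => produces A K c) J -> regular_production A J c ->
  forall K v, (forall i, 0 <= v i 0) -> v != 0 -> shift_mx A K c *m v = 0 ->
  K = J.
Proof.
move=> [_ uJ] /regular_kernel[m1 [v0 [v0pos Bv0]]] K v vge0 vn0 Bv.
have JE := uJ _ (kernel_produces vge0 vn0 Bv).
move/shift_kernelP: (Bv) => eq.
have BJv : shift_mx A J c *m v = 0.
  apply/shift_kernelP => i; rewrite JE sum_positive_part // -eq inE.
  case: ifPn => [/andP[-> _] //|]; case: ifP => //= iK.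
  by rewrite lt_neqAle vge0 andbT negbK => /eqP <-; rewrite !mulr0.
apply/setP => i; rewrite JE inE; case: (i \in K) => //=; apply/esym.
rewrite lt_neqAle vge0 andbT eq_sym; apply/negP => /eqP vi.
have := simple_root_kernel m1 Bv0 BJv (lt0r_neq0 (v0pos i)) vi.
by move/eqP; rewrite (negPf vn0).
Qed.

End ParetoKernel.

Theorem theorem3p2 (R : realType) (n : nat) (hn : (0 < n)%N) (A : 'M[R]_n)
    (hA : forall lambda : R, pareto_spectrum A lambda ->
       exists J : {set 'I_n},
         unique (fun K : {set 'I_n} => produces A K lambda) J /\
         regular_production A J lambda) :
  finite_set (pareto_spectrum A) /\
  (#|` fset_set (pareto_spectrum A)|)%fset = 1%N %[mod 2].
Proof.
pose P c := `[< pareto_spectrum A c >].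
have [||S [uS PS odd_count]] := @odd_regular_count R n A P hn.
- move=> c /asboolP/hA[J [uJ rJ]]; have [m1 [v [v0 Bv]]] := regular_kernel rJ.
  by exists J, v; split=> //; apply: regular_kernel_support uJ rJ.
- move=> c /asboolP nP J v v0 Bv; apply/eqP; apply: contraT => vn0.
  by case: nP; apply: kernel_pareto Bv.
(* [S] may contain other points; filtering by [P] leaves each Pareto eigenvalue exactly once. *)
have E : pareto_spectrum A = [set` filter P S]%classic.
  apply/seteqP; split=> c /=; rewrite mem_filter.
    by move=> pc; rewrite PS ?andbT; apply/asboolP.
  by case/andP => /asboolP.
split; first by rewrite E; exact: finite_seq.
rewrite E (_ : #|` _| = count P S)%fset; last first.
  rewrite -size_filter -(undup_id (filter_uniq P uS)) -card_fseq.
  congr (#|` _|)%fset; apply/fsetP => c.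
  rewrite in_fset_set ?inE; last exact: finite_seq.
  by rewrite mem_setE undup_id ?filter_uniq.
by rewrite modn2 odd_count.
Qed.
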